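(* Let $n\ge 3$ be an integer and let $A_1,\dots,A_n$ be real symmetric positive semidefinite matrices of the same size such that $A_1+\dots+A_n\preceq nI$. Then $$-\frac{n}{4(n-2)}\,I\preceq\widetilde{\mathbb{E}}_{i,j,k}A_iA_jA_k .$$
   Context: For real symmetric matrices $A,B$ of the same size, $A\preceq B$ (Loewner order) means that $B-A$ is positive semidefinite. $I$ is the identity matrix. $\widetilde{\mathbb{E}}_{i,j,k}$ denotes the average over all ordered triples of distinct indices $1\le i,j,k\le n$, i.e. $$\widetilde{\mathbb{E}}_{i,j,k}A_iA_jA_k=\frac{1}{n(n-1)(n-2)}\sum_{\substack{1\le i,j,k\le n\\ i,j,k\text{ distinct}}}A_iA_jA_k .$$ *)

(* Defs.v *)
From mathcomp Require Import all_boot all_order all_algebra.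
From mathcomp Require Import reals.

Set Implicit Arguments.
Unset Strict Implicit.
Unset Printing Implicit Defensive.

Import Order.TTheory GRing.Theory Num.Theory.
Local Open Scope ring_scope.

(* The product is a 1 x 1 matrix; its entry is the quadratic form x^T A x. *)
Definition psdmx (R : realType) (d : nat) (A : 'M[R]_d) : Prop :=
  A \is symmetricmx /\ forall x : 'cV[R]_d, 0 <= (x^T *m A *m x) 0 0.

Definition loewner_le (R : realType) (d : nat) (A B : 'M[R]_d) : Prop :=
  [/\ A \is symmetricmx, B \is symmetricmx & psdmx (B - A)].

(* The prefactor is computed in R, where the subtractions are not truncated. *)
Definition avg_distinct3 (R : realType) (n d : nat) (A : 'I_n -> 'M[R]_d) :
    'M[R]_d :=
  (n%:R * (n%:R - 1) * (n%:R - 2))^-1 *: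
    \sum_(i < n) \sum_(j < n) \sum_(k < n | [&& i != j, i != k & j != k])
      A i *m A j *m A k.

(* Main.v *)
Require Import Defs.
From mathcomp Require Import all_boot all_order all_algebra.
From mathcomp Require Import reals.
From mathcomp Require Import ring lra.

Set Implicit Arguments.
Unset Strict Implicit.
Unset Printing Implicit Defensive.

Import Order.TTheory GRing.Theory Num.Theory.
Local Open Scope ring_scope.

(* Put S = A_1 + ... + A_n and r = n. Summing over the middle index first, the
   sum over distinct triples is the sum over j of
   (S - A_j) A_j (S - A_j) - A_j (S - A_j) A_j. Completing squares in each term
   extracts the positive semidefinite matrices
   (S - A_j - r/8) A_j (S - A_j - r/8), A_j (r - S) A_j and
   (A_j - 5r/8) A_j (A_j - 5r/8). What remains sums to a polynomial of degree 2
   in S alone, bounded below by -(169/1024) r^3 through one more square; this is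
   stronger than the required -n^2 (n - 1)/4 as soon as n >= 3. *)

Lemma sum_distinct3 (V : pzRingType) (n : nat) (A : 'I_n -> V) :
  let S := \sum_(i < n) A i in
  \sum_(i < n) \sum_(j < n) \sum_(k < n | [&& i != j, i != k & j != k])
     A i * A j * A k =
  \sum_(j < n) ((S - A j) * A j * (S - A j) - A j * (S - A j) * A j).
Proof.
move=> S.
have others j : S - A j = \sum_(i < n | i != j) A i.
  by rewrite /S (bigD1 j) //= addrAC subrr add0r.
(* [S - A j] omits only the index j, so the term k = i has to be taken out separately. *)
have others2 i j : i != j ->
    \sum_(k < n | [&& i != j, i != k & j != k]) A i * A j * A k =
    A i * A j * (S - A j) - A i * A j * A i.
  move=> ij; rewrite -mulrBr others [in RHS](bigD1 i) //= addrAC subrr add0r mulr_sumr.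
  by apply: eq_bigl => k; rewrite ij (eq_sym k j) (eq_sym k i) /= andbC.
transitivity (\sum_(i < n) \sum_(j < n | i != j)
    (A i * A j * (S - A j) - A i * A j * A i)).
  apply: eq_bigr => i _; rewrite [RHS]big_mkcond; apply: eq_bigr => j _.
  by case: ifPn => [ij|_]; [rewrite -others2 // ij | rewrite big_pred0].
under eq_bigr => i _ do rewrite sumrB.
rewrite !sumrB; congr (_ - _).
  rewrite (exchange_big_dep xpredT) //=; apply: eq_bigr => j _.
  by rewrite -!mulr_suml -others.
(* In the terms A_i A_j A_i the outer index is the one kept; summing the middle factor over j gives
   S - A_i. *)
apply: eq_bigr => i _; rewrite -mulr_suml -mulr_sumr; congr (_ * _ * _).
by rewrite others; apply: eq_bigl => j; rewrite eq_sym.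
Qed.

Lemma symmetricmxP (R : realType) (d : nat) (M : 'M[R]_d) : reflect (M^T = M) (M \is symmetricmx).
Proof.
apply: (iffP (is_hermitianmxP _ _ _)); rewrite expr0 scale1r map_mx_id //.
Qed.

Lemma symmetricmx_scalar (R : realType) (d : nat) (a : R) :
  (a%:M : 'M[R]_d) \is symmetricmx.
Proof. by apply/symmetricmxP; rewrite tr_scalar_mx. Qed.

Lemma psdmxD (R : realType) (d : nat) (M N : 'M[R]_d) : psdmx M -> psdmx N -> psdmx (M + N).
Proof.
move=> [/symmetricmxP sM pM] [/symmetricmxP sN pN]; split.
  by apply/symmetricmxP; rewrite raddfD /= sM sN.
by move=> x; rewrite mulmxDr mulmxDl mxE addr_ge0.
Qed.

Lemma psdmxZ (R : realType) (d : nat) (a : R) (M : 'M[R]_d) :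
  0 <= a -> psdmx M -> psdmx (a *: M).
Proof.
move=> a0 [/symmetricmxP sM pM]; split.
  by apply/symmetricmxP; rewrite linearZ /= sM.
by move=> x; rewrite -scalemxAr -scalemxAl mxE mulr_ge0.
Qed.

Lemma psdmx_congr (R : realType) (d : nat) (M N : 'M[R]_d) :
  psdmx M -> N^T = N -> psdmx (N *m M *m N).
Proof.
move=> [/symmetricmxP sM pM] sN; split.
  by apply/symmetricmxP; rewrite !trmx_mul sM sN mulmxA.
move=> x; suff -> : x^T *m (N *m M *m N) *m x = (N *m x)^T *m M *m (N *m x) by [].
by rewrite trmx_mul sN !mulmxA.
Qed.

Lemma psdmx_scalar (R : realType) (d : nat) (a : R) :
  0 <= a -> psdmx (a%:M : 'M[R]_d).
Proof.
move=> a0; split; first exact: symmetricmx_scalar.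
move=> x; rewrite mul_mx_scalar -scalemxAl !mxE mulr_ge0 // sumr_ge0 // => i _.
by rewrite !mxE -expr2 sqr_ge0.
Qed.

Lemma psdmx_sum (R : realType) (d n : nat) (F : 'I_n -> 'M[R]_d) :
  (forall i, psdmx (F i)) -> psdmx (\sum_(i < n) F i).
Proof.
move=> hF; apply: (big_ind (@psdmx R d)) => //; last exact: psdmxD.
by rewrite -(scale0r 1%:M) scalemx1; apply: psdmx_scalar.
Qed.


(* The shift r/8 in the first square is a free parameter c: the second shift is
   then forced to be (r + 2c)/2, and c is chosen to make the final constant at
   most r^3/6, the value required by n = 3. *)
Lemma sandwich_identity (R : realType) (d : nat) (r : R) (A S : 'M[R]_d) :
  (S - A) *m A *m (S - A) - A *m (S - A) *m A =
  (S - A - (r / 8)%:M) *m A *m (S - A - (r / 8)%:M)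
  + A *m (r%:M - S) *m A
  + (A - (5 * r / 8)%:M) *m A *m (A - (5 * r / 8)%:M)
  + ((r / 8) *: (S *m A + A *m S) - (13 * r ^+ 2 / 32) *: A).
Proof.
rewrite !(mulmxBl, mulmxBr, mul_scalar_mx, mul_mx_scalar).
rewrite -!(scalemxAl, scalemxAr) -!mulmxA.
(* Both sides are linear combinations of these noncommutative words; once they are atoms, the
   identity can be checked entry by entry. *)
move: (S *m (A *m S)) (S *m (A *m A)) (A *m (A *m S)) (A *m (S *m A))
  (A *m (A *m A)) (S *m A) (A *m S) (A *m A) => SAS SAA AAS ASA AAA SA AS AA.
by apply/matrixP => i j; rewrite !mxE; field.
Qed.

(** The left side is the last group of [sandwich_identity] summed over all A_j, whose sum is S. The
    factor [1%:M] gives the square the shape that [psdmx_congr] handles. *)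
Lemma square_identity (R : realType) (d : nat) (r : R) (S : 'M[R]_d) :
  (r / 8) *: (S *m S + S *m S) - (13 * r ^+ 2 / 32) *: S =
  (r / 4) *: ((S - (13 * r / 16)%:M) *m 1%:M *m (S - (13 * r / 16)%:M))
  - (169 / 1024 * r ^+ 3)%:M.
Proof.
rewrite mulmx1 !(mulmxBl, mulmxBr, mul_scalar_mx, mul_mx_scalar).
move: (S *m S) => SS.
by apply/matrixP => i j; rewrite !mxE; case: (i == j); rewrite ?mulr1n ?mulr0n; field.
Qed.

Lemma psdmx_distinct3 (R : realType) (n d : nat) (r : R) (A : 'I_n -> 'M[R]_d) :
  0 <= r -> (forall i, psdmx (A i)) ->
  loewner_le (\sum_(i < n) A i) r%:M ->
  psdmx (\sum_(i < n) \sum_(j < n)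
           \sum_(k < n | [&& i != j, i != k & j != k]) A i *m A j *m A k
         + (169 / 1024 * r ^+ 3)%:M).
Proof.
move=> r0 hA [/symmetricmxP symS _ psdS].
rewrite (sum_distinct3 (V := 'M[R]_d)); set S := \sum_(i < n) A i in symS psdS *.
have symA i : (A i)^T = A i by apply/symmetricmxP; case: (hA i).
rewrite (eq_bigr _ (fun j _ => sandwich_identity r (A j) S)).
rewrite big_split /= sumrB -!scaler_sumr.
rewrite [X in _ *: X]big_split /= -mulmx_sumr -mulmx_suml.
rewrite square_identity addrA subrK; apply: psdmxD; last first.
  apply: psdmxZ; first by rewrite divr_ge0.
  by apply: psdmx_congr; [exact: psdmx_scalar | rewrite !raddfB /= symS tr_scalar_mx].
(* The bound of S by r enters only through the middle term A_j (r - S) A_j. *)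
apply: psdmx_sum => j; apply: psdmxD; first apply: psdmxD.
- by apply: psdmx_congr; rewrite // !raddfB /= symS symA tr_scalar_mx.
- exact: psdmx_congr.
- by apply: psdmx_congr; rewrite // raddfB /= symA tr_scalar_mx.
Qed.

Theorem mainTheorem4 (R : realType) (n d : nat) (A : 'I_n -> 'M[R]_d)
    (hn : (3 <= n)%N)
    (hA : forall i : 'I_n, psdmx (A i))
    (hsum : loewner_le (\sum_(i < n) A i) (n%:R)%:M) :
  loewner_le (- (n%:R / (4 * (n%:R - 2))))%:M (avg_distinct3 A).
Proof.
have n3 : 3 <= n%:R :> R by rewrite (ler_nat R 3).
have psdX := psdmx_distinct3 (ler0n R n) hA hsum.
rewrite /avg_distinct3; set X := \sum_(i < n) _ in psdX *.
set r : R := n%:R in n3 psdX *; set p := r * (r - 1) * (r - 2).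
have p0 : 0 < p by rewrite !mulr_gt0 //; lra.
set c := 169 / 1024 * r ^+ 3 in psdX.
(* Symmetry of X is read off from that of X + c, which is part of [psdX], so no reindexing of
   triples is needed. *)
have symX : X \is symmetricmx.
  case: psdX => /symmetricmxP; rewrite raddfD /= tr_scalar_mx => /addIr symX _.
  exact/symmetricmxP.
split; first exact: symmetricmx_scalar.
  by apply/symmetricmxP; rewrite linearZ /= (symmetricmxP _ symX).
have -> : p^-1 *: X - (- (r / (4 * (r - 2))))%:M =
    p^-1 *: (X + c%:M) + (r / (4 * (r - 2)) - p^-1 * c)%:M.
  rewrite scalerDr scale_scalar_mx -addrA; congr (_ + _).
  by rewrite -raddfD -raddfN /= opprK addrCA subrr addr0.
apply: psdmxD; first by apply: psdmxZ => //; rewrite invr_ge0 ltW.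
apply: psdmx_scalar.
(* The slack is nonnegative because 87 r >= 261 > 256 when r >= 3. *)
have -> : r / (4 * (r - 2)) - p^-1 * c =
    r * (87 * r - 256) / (1024 * ((r - 1) * (r - 2))).
  by rewrite /c /p; field; rewrite !lt0r_neq0 //; lra.
by rewrite divr_ge0 ?mulr_ge0 //; lra.
Qed.
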